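(* For each integer $k\geq 1$ and real $\epsilon>0$ there are $N=N(\epsilon,k)$ and $n_0=n_0(\epsilon,k)$ such that for every $k$-edge stable graph $G$ with at least $n_0$ vertices there is a partition of the vertex set of $G$ into disjoint pieces $A_0,\dots,A_{\ell-1}$ with $\ell\leq N$ such that: (a) the partition is equitable, i.e. for all $i,j<\ell$, $|A_i|$ and $|A_j|$ differ by at most $1$; (b) each $A_i$ is $\epsilon$-excellent; (c) every pair $(A_i,A_j)$ is $\epsilon$-uniform; (d) if $\epsilon<\frac{1}{2^t}$, where $t=2^{k+2}-2$, then $N$ may be taken with $N\leq 4\left(\frac{8}{\epsilon}\right)^{t-2}$.
   Context: A graph is a finite set of vertices with a symmetric irreflexive edge relation $R$; a subset $A\subseteq G$ of vertices is regarded as the induced subgraph, and $|A|$ is its number of vertices. For a formula $\varphi$ write $\varphi^1=\varphi$ and $\varphi^0=\neg\varphi$. A graph $G$ is $k$-edge stable if there do not exist distinct vertices $a_1,\dots,a_k,b_1,\dots,b_k$ of $G$ such that $R(a_i,b_j)$ holds iff $i<j$. (The number $t=2^{k+2}-2$ is the ''tree bound'': a $k$-edge stable graph contains no full special tree of height $t$.) A set $A\subseteq G$ is $\epsilon$-good if for every vertex $b\in G$, either $|\{a\in A: R(b,a)\}|<\epsilon|A|$ or $|\{a\in A:\neg R(b,a)\}|<\epsilon|A|$; in that case $\mathbf{t}(b,A)\in\{0,1\}$ denotes a truth value such that for all but fewer than $\epsilon|A|$ elements $a\in A$, $R(b,a)^{\mathbf{t}(b,A)}$ holds. A set $A\subseteq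 G$ is $\epsilon$-excellent if for every $\epsilon$-good $B\subseteq G$, either $|\{a\in A:\mathbf{t}(a,B)=1\}|<\epsilon|A|$ or $|\{a\in A:\mathbf{t}(a,B)=0\}|<\epsilon|A|$. A pair $(A,B)$ of vertex sets is $\epsilon$-uniform if there is a truth value $\mathbf{t}\in\{0,1\}$ such that for all but fewer than $\epsilon|A|$ elements $a\in A$, for all but fewer than $\epsilon|B|$ elements $b\in B$, $R(a,b)^{\mathbf{t}}$ holds.
   Formalization: The value ε = 1/2 is excluded, because the claim fails there for k ≥ 3: in the join of two perfect matchings on 2^j vertices each, no nonempty set of even size is 1/2-excellent, so the pieces would have to be singletons. *)

(* Defs.v *)
From mathcomp Require Import all_boot all_order all_algebra.
From mathcomp Require Import reals.

Set Implicit Arguments.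
Unset Strict Implicit.
Unset Printing Implicit Defensive.

Import Order.TTheory GRing.Theory Num.Theory.

Local Open Scope ring_scope.

Definition edge_stable (k : nat) (T : finType) (E : rel T) : Prop :=
  ~ exists a b : 'I_k -> T,
      [/\ injective a, injective b, (forall i j, a i <> b j) &
          forall i j : 'I_k, E (a i) (b j) = (i < j)%N].

Definition tree_bound (k : nat) : nat := (2 ^ (k + 2) - 2)%N.

Section Excellence.
Variables (R : realType) (eps : R) (T : finType) (E : rel T).

Definition all_but_few (A : {set T}) (P : pred T) : bool :=
  #|[set a in A | ~~ P a]|%:R < eps * #|A|%:R.

Definition good (A : {set T}) : Prop :=
  forall b : T, #|[set a in A | E b a]|%:R < eps * #|A|%:R \/
                #|[set a in A | ~~ E b a]|%:R < eps * #|A|%:R.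

(* [truth_value b A v] says that v is a legitimate value of t(b, A). For good A
   such a v exists, and it is unique as soon as eps <= 1/2. *)
Definition truth_value (b : T) (A : {set T}) (v : bool) : Prop :=
  all_but_few A (fun a => E b a == v).

(* When eps > 1/2 the value t(a, B) need not be determined by a and B, so the
   condition is required for every choice of the function t(-, B). *)
Definition excellent (A : {set T}) : Prop :=
  forall B : {set T}, good B ->
  forall t : T -> bool, (forall a, truth_value a B (t a)) ->
    #|[set a in A | t a == true]|%:R < eps * #|A|%:R \/
    #|[set a in A | t a == false]|%:R < eps * #|A|%:R.

Definition uniform (A B : {set T}) : Prop :=
  exists v : bool,
    all_but_few A (fun a => all_but_few B (fun b => E a b == v)).

End Excellence.

(* Main.v *)
Require Import Defs.
From mathcomp Require Import all_boot all_order all_algebra.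
From mathcomp Require Import reals.
From mathcomp Require Import zify ring lra.

(** For [eps > 1/2] the one-piece partition works, so let [eps < 1/2]. Suppose a
    full binary tree has its nodes labelled by eps-good sets [B] and its leaves by
    vertices whose values [t(-, B)] follow the branches. Replacing each [B], from
    the root down, by one well-chosen vertex of [B] keeps a fraction [1 - eps] of
    the leaves below it; at height [h] at least [(2 (1 - eps)) ^ h] leaves survive,
    and by a Sauer-Shelah count they contain a full tree of the graph itself, of
    height [3 * 2 ^ k - 3]. Such a tree yields a half-graph of length [k], against
    stability. Hence the trees of good sets have bounded height, with two
    consequences. Splitting a set along good sets stops at a large subset that no
    good set splits in a proportion above [zeta = eps / 64]; and there are only
    polynomially many functions [t(-, B)], so that such a subset contains one of
    any prescribed linear size with almost the same property. Such subsets of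
    equal size are removed greedily and the few remaining vertices are spread
    evenly over them. Uniformity of pairs follows from excellence. *)

Set Implicit Arguments.
Unset Strict Implicit.
Unset Printing Implicit Defensive.

Import Order.TTheory GRing.Theory Num.Theory.

(** * Binary trees and half-graphs *)

Section Trees.
Variables (I T : finType) (N : I -> {set T}).
Implicit Types (Y : {set I}) (X : {set T}) (C : {set I}).

(** Leaves are encoded by the demand that [X] meet every branch, a branch being read as a sequence
    of sign conditions. Labels may repeat. *)
Fixpoint full_tree Y (d : nat) X : Prop :=
  if d is d'.+1 then
    exists i, [/\ i \in Y, full_tree Y d' (X :&: N i) & full_tree Y d' (X :\: N i)]
  else X != set0.

(** Branches may be empty here: a tree of height [d] separates the elements of [X], at most one per
    branch. *)
Fixpoint partial_tree Y (d : nat) X : Prop :=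
  if d is d'.+1 then
    exists i, [/\ i \in Y, partial_tree Y d' (X :&: N i)
                & partial_tree Y d' (X :\: N i)]
  else #|X| <= 1.

Lemma full_tree_sub Y d X X' : X \subset X' -> full_tree Y d X -> full_tree Y d X'.
Proof.
elim: d X X' => [|d IH] X X' sX /=.
  by case/set0Pn=> x xX; apply/set0Pn; exists x; apply: (subsetP sX).
case=> i [iY h1 h2]; exists i; split=> //.
  by apply: IH h1; apply: setSI.
by apply: IH h2; apply: setSD.
Qed.

Lemma full_tree_neq0 Y d X : full_tree Y d X -> X != set0.
Proof.
elim: d X => [|d IH] X //= [i [_ /IH /set0Pn [x] + _]].
by rewrite inE => /andP [xX _]; apply/set0Pn; exists x.
Qed.

Lemma partial_tree_sub Y d X X' :
  X' \subset X -> partial_tree Y d X -> partial_tree Y d X'.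
Proof.
elim: d X X' => [|d IH] X X' sX /=.
  by apply: leq_trans; apply: subset_leq_card.
case=> i [iY h1 h2]; exists i; split=> //.
  by apply: IH h1; apply: setSI.
by apply: IH h2; apply: setSD.
Qed.

Lemma setU_split (S X1 X2 : {set T}) : X1 \subset S -> X2 \subset ~: S ->
  (X1 :|: X2) :&: S = X1 /\ (X1 :|: X2) :\: S = X2.
Proof.
move=> s1 s2; rewrite setIUl setDUl (setIidPl s1).
have /eqP -> : X2 :&: S == set0 by rewrite -[S in X2 :&: S]setCK -setDE setD_eq0.
have /eqP -> : X1 :\: S == set0 by rewrite setD_eq0.
by rewrite setU0 set0U setDE (setIidPl s2).
Qed.

Lemma partial_treeU Y d i X1 X2 : i \in Y ->
  X1 \subset N i -> X2 \subset ~: N i ->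
  partial_tree Y d X1 -> partial_tree Y d X2 -> partial_tree Y d.+1 (X1 :|: X2).
Proof.
by move=> iY s1 s2 t1 t2; exists i; case: (setU_split s1 s2) => -> ->.
Qed.

Lemma full_tree_leaves Y d X : full_tree Y d X ->
  exists X', [/\ X' \subset X, #|X'| = 2 ^ d & partial_tree Y d X'].
Proof.
elim: d X => [|d IH] X /=.
  by case/set0Pn=> x xX; exists [set x]; rewrite sub1set cards1.
case=> i [iY /IH [X1 [+ c1 t1]] /IH [X2 [+ c2 t2]]].
rewrite subsetI setDE subsetI => /andP [sX1 sN1] /andP [sX2 sN2].
exists (X1 :|: X2); split; [by rewrite subUset sX1 | | exact: (partial_treeU iY)].
rewrite -(cardsID (N i)); case: (setU_split sN1 sN2) => -> ->.
by rewrite c1 c2 expnS mul2n addnn.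
Qed.

(* The Sauer-Shelah bound for binary trees. *)
Lemma full_tree_of_partial Y h d X : partial_tree Y h X ->
  \sum_(i < d) 'C(h, i) < #|X| -> full_tree Y d X.
Proof.
elim: h d X => [|h IH] [|d] X /=; rewrite ?big_ord0 ?card_gt0 //.
  by rewrite big_ord_recl bin0 ltnNge => c1; rewrite (leq_trans c1).
case=> i [iY t1 t2]; rewrite -(cardsID (N i) X) => lt.
have eqS : \sum_(j < d.+1) 'C(h.+1, j) =
    \sum_(j < d.+1) 'C(h, j) + \sum_(j < d) 'C(h, j).
  rewrite big_ord_recl bin0 (eq_bigr (fun j : 'I_d => 'C(h, j.+1) + 'C(h, j)));
    last by move=> j _; rewrite binS.
  by rewrite big_split /= addnA; congr (_ + _); rewrite [RHS]big_ord_recl bin0.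
rewrite eqS in lt.
case: (ltnP (\sum_(j < d.+1) 'C(h, j)) #|X :&: N i|) => [lt1|le1].
  by apply: full_tree_sub (subsetIl X (N i)) (IH d.+1 _ t1 lt1).
case: (ltnP (\sum_(j < d.+1) 'C(h, j)) #|X :\: N i|) => [lt2|le2].
  by apply: full_tree_sub (subsetDl X (N i)) (IH d.+1 _ t2 lt2).
by exists i; split=> //; apply: IH => //; lia.
Qed.

(** Colour nodes by membership in [C]. If neither subtree contains the tree in the colour opposite
    to the root's, both contain one a level short in the root's colour, and the root completes
    it. *)
Lemma full_tree_Ramsey Y C p q X : full_tree Y (p + q) X ->
  full_tree (Y :&: C) p X \/ full_tree (Y :\: C) q.+1 X.
Proof.
have [d] := ubnP (p + q); elim: d p q X => // d IH [|p] q X.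
  by move=> _ /full_tree_neq0; left.
rewrite addSn ltnS => led [i [iY t1 t2]].
have [iC|niC] := boolP (i \in C).
  case: (IH p q _ led t1) => [l1|r1]; last first.
    by right; apply: full_tree_sub r1; apply: subsetIl.
  case: (IH p q _ led t2) => [l2|r2]; last first.
    by right; apply: full_tree_sub r2; apply: subsetDl.
  by left; exists i; rewrite inE iY iC.
case: q led t1 t2 => [|q] led t1 t2.
  right; exists i; rewrite inE niC iY.
  by split; [| apply: full_tree_neq0 t1 | apply: full_tree_neq0 t2].
rewrite -addSnnS in led t1 t2.
case: (IH p.+1 q _ led t1) => [l1|r1].
  by left; apply: full_tree_sub l1; apply: subsetIl.
case: (IH p.+1 q _ led t2) => [l2|r2].
  by left; apply: full_tree_sub l2; apply: subsetDl.
by right; exists i; rewrite inE niC iY.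
Qed.

(** The element [x] lies on one side of the root only, so the other subtree survives its removal. *)
Lemma full_treeD1 Y d X x : full_tree Y d.+1 X -> full_tree Y d (X :\ x).
Proof.
case=> i [_ t1 t2]; have [xN|xN] := boolP (x \in N i).
  apply: full_tree_sub t2; apply/subsetP=> y; rewrite !inE => /andP [yN ->].
  by rewrite andbT; apply: contraNneq yN => ->.
apply: full_tree_sub t1; apply/subsetP=> y; rewrite !inE => /andP [-> yN].
by rewrite andbT; apply: contraNneq xN => <-.
Qed.

Lemma full_tree_node1 i X : ~ full_tree [set i] 2 X.
Proof.
case=> j [/set1P -> [l [/set1P -> _ /set0Pn [x xN]]] _]; move: xN.
by rewrite !inE; case: (x \in N i); rewrite ?andbF.
Qed.

(** The Ramsey alternative, with [q = 1], is a tree of height 2 all of whose nodes are [i]; a second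
    test against [N i] separates nothing. *)
Lemma full_tree_remove_node Y d X i : full_tree Y d.+1 X -> full_tree (Y :\ i) d X.
Proof.
rewrite -addn1 => /(full_tree_Ramsey [set~ i]) [].
  by rewrite -setDE.
move=> t; case: (@full_tree_node1 i X); move: t => [j [jY t1 t2]].
have sub1 Z : full_tree (Y :\: [set~ i]) 1 Z -> full_tree [set i] 1 Z.
  case=> l [+ u1 u2]; rewrite !inE negbK => /andP [/eqP li _].
  by rewrite li in u1 u2; exists i; rewrite inE eqxx.
move: jY; rewrite !inE negbK => /andP [/eqP ji _]; rewrite ji in t1 t2.
by exists i; split; [rewrite inE | apply: sub1 | apply: sub1].
Qed.

End Trees.

Definition ladder (T : finType) (E : rel T) (X Y : {set T}) (n : nat) : Prop :=
  exists a b : nat -> T,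
    [/\ forall i, i < n -> a i \in X, forall i, i < n -> b i \in Y,
        forall i j, i < n -> j < n -> a i != b j
      & forall i j, i < n -> j < n -> E (a i) (b j) = (i < j)].

Section Ladder.
Variables (T : finType) (E : rel T).
Hypotheses (symE : symmetric E) (irrE : irreflexive E).

Definition nbhd (b : T) : {set T} := [set a | E a b].

(* One step costs 2d + 3 levels to go from height d: one for the root x, one to
   drop the leaf equal to x, one to drop the nodes equal to the chosen leaf a, and
   2d to find below them either d levels of neighbours of a, or d + 1 levels of
   non-neighbours. *)
Lemma ladder_of_full_tree n (X Y : {set T}) :
  full_tree nbhd Y (3 * 2 ^ n - 3) X -> ladder E X Y n.
Proof.
elim: n X Y => [|n IH] X Y.
  case/full_tree_neq0/set0Pn => x _; exists (fun=> x), (fun=> x).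
  by split.
set d := 3 * 2 ^ n - 3 in IH *.
have -> : 3 * 2 ^ n.+1 - 3 = (d + d).+1.+2.
  by rewrite /d expnS; have := expn_gt0 2 n; lia.
case=> x [xY _ t0]; have t := @full_treeD1 _ _ _ Y (d + d).+1 _ x t0.
set X' := (X :\: nbhd x) :\ x in t.
have /set0Pn [a aX'] := full_tree_neq0 t.
have aX : a \in X by move: aX'; rewrite !inE => /and3P [].
have ax : a != x by move: aX'; rewrite !inE => /and3P [].
have Eax : E a x = false by move: aX'; rewrite !inE => /and3P [_ /negbTE].
case: (full_tree_Ramsey (nbhd a) (full_tree_remove_node a t)).
  case/IH=> u [v [uX vY uv Euv]].
  (* Neighbours of [a]: the pair [a], [x] goes in front, since [a] is adjacent to every [v j] and no
     [u i] is adjacent to [x]. *)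
  exists (fun i => if i is j.+1 then u j else a).
  exists (fun i => if i is j.+1 then v j else x).
  split.
  - by case=> [|i] // /uX; rewrite !inE => /and3P [].
  - by case=> [|i] // /vY; rewrite !inE => /andP [/andP []].
  - case=> [|i] [|j] //= hi hj.
    + by have := vY j hj; rewrite !inE eq_sym => /andP [/andP []].
    + by have := uX i hi; rewrite !inE => /andP [].
    + exact: uv.
  - case=> [|i] [|j] //= hi hj.
    + by have := vY j hj; rewrite !inE symE => /andP [].
    + by have := uX i hi; rewrite !inE => /and3P [_ /negbTE].
    + by rewrite Euv.
(* Non-neighbours of [a]: the extra level supplies a root [y]. The leaves on its neighbour side are
   adjacent to [y], so the pair [a], [y] goes at the end. *)
case=> y [+ + _]; rewrite !inE => /and3P [nEya ya yY].
case/IH=> u [v [uX vY uv Euv]].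
have Eay : E a y = false by rewrite symE (negbTE nEya).
exists (fun i => if i < n then u i else a).
exists (fun i => if i < n then v i else y).
split.
- move=> i _; case: ifP => // hi.
  by have := uX i hi; rewrite !inE => /andP [/and3P []].
- move=> i _; case: ifP => // hi.
  by have := vY i hi; rewrite !inE => /and3P [].
- move=> i j _ _; case: ifP => hi; case: ifP => hj.
  + exact: uv.
  + have := uX i hi; rewrite !inE => /andP [_]; apply: contraTneq => ->.
    by rewrite irrE.
  + by have := vY j hj; rewrite !inE eq_sym => /and3P [].
  + by rewrite eq_sym.
- move=> i j li lj; case: ifP => hi; case: ifP => hj.
  + exact: Euv.
  + by have := uX i hi; rewrite !inE => /andP [_ ->]; lia.
  + have := vY j hj; rewrite !inE symE => /and3P [/negbTE -> _ _]; lia.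
  + rewrite Eay; lia.
Qed.

Lemma stable_no_full_tree k (X Y : {set T}) : edge_stable k E ->
  ~ full_tree nbhd Y (3 * 2 ^ k - 3) X.
Proof.
move=> st /ladder_of_full_tree [a [b [_ _ ab Eab]]]; apply: st.
exists (fun i : 'I_k => a i), (fun i : 'I_k => b i).
(* Equal entries at [i < j] would give an edge the value of a diagonal pair, which is false. *)
have key i j : i < k -> j < k -> i < j -> a i <> a j /\ b i <> b j.
  move=> hi hj ij; split=> e.
    by have := Eab i j hi hj; rewrite e Eab // ltnn ij.
  by have := Eab i j hi hj; rewrite -e Eab // ltnn ij.
split.
- move=> i j e; apply: val_inj => /=.
  case: (ltngtP i j) => // lt; case: (key _ _ _ _ lt) => //.
  by rewrite e.
- move=> i j e; apply: val_inj => /=.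
  case: (ltngtP i j) => // lt; case: (key _ _ _ _ lt) => //.
  by rewrite e.
- by move=> i j; apply/eqP; apply: ab.
- by move=> i j; apply: Eab.
Qed.

End Ladder.

(** * Shattering *)

Lemma exists_subset_card (T : finType) (A : {set T}) m : (m <= #|A|)%N ->
  exists2 W : {set T}, W \subset A & #|W| = m.
Proof.
case/card_geqP=> s [us cs sA]; exists [set x in s].
  by apply/subsetP=> x; rewrite inE; apply: sA.
by rewrite cardsE (card_uniqP us).
Qed.

Lemma bin_le_exp n i : 'C(n, i) <= n ^ i.
Proof.
elim: i => [|i IH]; first by rewrite bin0.
by rewrite expnS; apply: leq_trans (leq_mul (leqnn _) IH); have := mul_bin_left n i; nia.
Qed.

Lemma sum_bin_le n d : 0 < n -> \sum_(i < d) 'C(n, i) <= n.+1 ^ d.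
Proof.
move=> n0; elim: d => [|d IH]; first by rewrite big_ord0.
rewrite big_ord_recr /=; apply: leq_trans (leq_add IH (bin_le_exp n d)) _.
have : n ^ d <= n.+1 ^ d by case: (d) => // e; rewrite leq_exp2r.
rewrite expnS mulSn; nia.
Qed.

Section Shattering.
Variable T : finType.
Implicit Types (F : {set {set T}}) (X S : {set T}).

Definition shattered F : {set {set T}} :=
  [set X : {set T} | [forall Z : {set T}, (Z \subset X) ==> [exists S in F, X :&: S == Z]]].

Lemma shatteredP F X :
  reflect (forall Z : {set T}, Z \subset X -> exists2 S, S \in F & X :&: S = Z)
          (X \in shattered F).
Proof.
rewrite inE; apply: (iffP forallP) => h Z.
  by move=> sZ; have /existsP [S /andP [SF /eqP e]] := implyP (h Z) sZ; exists S.
apply/implyP=> /h [S SF e]; apply/existsP; exists S.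
by rewrite SF e eqxx.
Qed.

Lemma shattered_sub F F' : F \subset F' -> shattered F \subset shattered F'.
Proof.
move=> sF; apply/subsetP=> X /shatteredP h; apply/shatteredP=> Z /h [S SF e].
by exists S => //; apply: (subsetP sF).
Qed.

Lemma sub_shattered F X X' : X' \subset X -> X \in shattered F -> X' \in shattered F.
Proof.
move=> sX' /shatteredP shX; apply/shatteredP=> Z sZ.
have [S SF e] := shX _ (subset_trans sZ sX').
by exists S => //; rewrite -(setIidPl sX') -setIA e; apply/setIidPr.
Qed.

(* Pajor's form of the Sauer-Shelah lemma: split the family at an element x on
   which two members disagree. *)
Lemma card_shattered F : #|F| <= #|shattered F|.
Proof.
have [n] := ubnP #|F|; elim: n F => // n IH F; rewrite ltnS => leF.
have [->|/set0Pn [S SF]] := eqVneq F set0; first by rewrite cards0.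
have [/eqP FS|] := eqVneq F [set S].
  rewrite (eqP FS) cards1 card_gt0; apply/set0Pn; exists set0.
  apply/shatteredP=> Z; rewrite subset0 => /eqP ->.
  by exists S; rewrite ?inE // set0I.
rewrite eqEsubset sub1set SF andbT => /subsetPn [S' S'F].
rewrite inE => neS.
have [x xSS'] : exists x, (x \in S) != (x \in S').
  apply/existsP; apply: contraR neS; rewrite negb_exists => /forallP h.
  by apply/eqP/setP=> y; have := h y; rewrite negbK => /eqP.
pose F1 := [set Z in F | x \in Z]; pose F0 := [set Z in F | x \notin Z].
have F10 : F1 :|: F0 = F.
  by apply/setP=> Z; rewrite !inE -andb_orr orbN andbT.
have dF : [disjoint F1 & F0].
  rewrite -setI_eq0; apply/eqP/setP=> Z; rewrite !inE.
  by case: (x \in Z); rewrite ?andbF.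
have cF : #|F| = #|F1| + #|F0|.
  by rewrite -F10 cardsU disjoint_setI0 // cards0 subn0.
have c1 : 0 < #|F1|.
  rewrite card_gt0; apply/set0Pn; move: xSS'.
  by case xS: (x \in S); case xS': (x \in S') => // _;
    [exists S | exists S']; rewrite inE ?SF ?S'F.
have c0 : 0 < #|F0|.
  rewrite card_gt0; apply/set0Pn; move: xSS'.
  by case xS: (x \in S); case xS': (x \in S') => // _;
    [exists S' | exists S]; rewrite inE ?SF ?S'F ?xS ?xS'.
have IH1 : #|F1| <= #|shattered F1| by apply: IH; lia.
have IH0 : #|F0| <= #|shattered F0| by apply: IH; lia.
have nx1 X : X \in shattered F1 -> x \notin X.
  move=> /shatteredP /(_ set0 (sub0set _)) [Z]; rewrite inE => /andP [_ xZ] e.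
  by apply/negP=> xX; have := in_set0 x; rewrite -e inE xX xZ.
have nx0 X : X \in shattered F0 -> x \notin X.
  move=> /shatteredP /(_ X (subxx _)) [Z]; rewrite inE => /andP [_ xZ] e.
  by apply: contra xZ; rewrite -e inE => /andP [].
(* A set shattered by both halves stays shattered by [F] after adding [x]. These enlarged sets
   contain [x], unlike any set shattered by one half, so they make up for the double counting in the
   union. *)
pose G := [set x |: X | X in shattered F1 :&: shattered F0].
have cG : #|G| = #|shattered F1 :&: shattered F0|.
  apply: card_in_imset => X X' /setIP [/nx1 n1 _] /setIP [/nx1 n2 _] e.
  by rewrite -(setU1K n1) e setU1K.
have dG : [disjoint shattered F1 :|: shattered F0 & G].
  rewrite -setI_eq0 -subset0; apply/subsetP=> X /setIP [h /imsetP [X' _ eX]].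
  have : x \notin X by case/setUP: h => [/nx1|/nx0].
  by rewrite eX setU11.
have sF1 : F1 \subset F by rewrite -F10 subsetUl.
have sF0 : F0 \subset F by rewrite -F10 subsetUr.
apply: (@leq_trans #|(shattered F1 :|: shattered F0) :|: G|).
  rewrite [#|_ :|: G|]cardsU (disjoint_setI0 dG) cards0 subn0 cG cardsU.
  rewrite subnK; first by rewrite cF leq_add.
  by rewrite (leq_trans (subset_leq_card (subsetIl _ _))) ?leq_addr.
apply: subset_leq_card; rewrite !subUset !shattered_sub //=.
apply/subsetP=> _ /imsetP [X /setIP [X1 X0] ->]; apply/shatteredP=> Z sZ.
have sZ' : Z :\ x \subset X by rewrite subDset.
have [xZ|xZ] := boolP (x \in Z).
  have [S1 S1F e] := shatteredP _ _ X1 _ sZ'.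
  move: (S1F); rewrite inE => /andP [? xS1]; exists S1 => //.
  by rewrite setIUl e (setIidPl _) ?sub1set // setD1K.
have [S0 S0F e] := shatteredP _ _ X0 _ sZ'.
move: (S0F); rewrite inE => /andP [? xS0]; exists S0 => //.
rewrite setIUl e; have -> : [set x] :&: S0 = set0.
  by apply/eqP; rewrite setI_eq0 disjoints1.
by rewrite set0U; apply/setDidPl; rewrite disjoint_sym disjoints1.
Qed.

(** Some member of the family cuts [X] in half and serves as root; both halves are again
    shattered. *)
Lemma full_tree_shattered F h X : X \in shattered F -> #|X| = 2 ^ h ->
  full_tree id F h X.
Proof.
elim: h X => [|h IH] X shX cX /=; first by rewrite -card_gt0 cX.
have [Z sZ cZ] : exists2 Z : {set T}, Z \subset X & #|Z| = 2 ^ h.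
  by apply: exists_subset_card; rewrite cX leq_exp2l.
have [S SF e] := shatteredP _ _ shX _ sZ.
exists S; split=> //; apply: IH; rewrite ?(sub_shattered _ shX) ?subsetIl ?subsetDl ?e //.
have := cardsID S X; rewrite e cX cZ expnS; lia.
Qed.

Lemma card_small_sets d :
  #|[set X : {set T} | #|X| < d]| <= \sum_(i < d) 'C(#|T|, i).
Proof.
elim: d => [|d IH].
  by rewrite (_ : [set _ | _] = set0) ?cards0 //; apply/setP=> X; rewrite !inE.
have -> : [set X : {set T} | #|X| < d.+1] =
    [set X : {set T} | #|X| < d] :|: [set X : {set T} | #|X| == d].
  by apply/setP=> X; rewrite !inE ltnS leq_eqVlt orbC.
apply: leq_trans (leq_card_setU _ _) _.
by rewrite card_draws big_ord_recr leq_add2r.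
Qed.

Lemma card_family_le F h : 0 < #|T| ->
  (forall X, ~ full_tree id F h X) -> #|F| <= #|T|.+1 ^ (2 ^ h).
Proof.
move=> T0 noF; apply: leq_trans (card_shattered F) _.
apply: leq_trans (sum_bin_le _ T0).
apply: leq_trans (card_small_sets _); apply: subset_leq_card.
apply/subsetP=> X shX; rewrite inE ltnNge; apply/negP.
case/exists_subset_card=> Z sZ cZ; apply: (noF Z).
exact: full_tree_shattered (sub_shattered sZ shX) cZ.
Qed.

End Shattering.

(** * Trees of good sets *)

Local Open Scope ring_scope.

Lemma Bernoulli_le (R : realDomainType) (u : R) n : -1 <= u -> 1 + n%:R * u <= (1 + u) ^+ n.
Proof.
move=> u1; elim: n => [|n IH]; first by rewrite mul0r addr0 expr0.
rewrite exprS; apply: le_trans (ler_wpM2l _ IH); last by lra.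
rewrite -natr1; have : 0 <= n%:R * u ^+ 2 by rewrite mulr_ge0 ?sqr_ge0.
by nra.
Qed.

Lemma exp_gt_poly (R : archiRealFieldType) (y : R) d : 1 < y ->
  exists n0 : nat, forall n : nat, (n0 <= n)%N -> n.+1%:R ^+ d < y ^+ n.
Proof.
move=> y1; pose u := y - 1; have u0 : 0 < u by rewrite /u; lra.
(* With [j = n %/ d.+1], the left side is at most the [d]-th power of [2 * d.+1 * j] and the right
   side at least the [d.+1]-st power of [j * u]; the latter wins once [j > c]. *)
pose c : R := (2 * d.+1)%:R ^+ d / u ^+ d.+1.
have c0 : 0 <= c by rewrite divr_ge0 ?exprn_ge0 ?ler0n // ltW.
pose j0 := (Num.truncn c).+1; exists (d.+1 * j0)%N => n len.
pose j := (n %/ d.+1)%N.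
have lej : (j0 <= j)%N by rewrite leq_divRL // mulnC.
have cj : c < j%:R by rewrite (lt_le_trans (truncnS_gt c)) ?ler_nat.
have nj : (n.+1 <= 2 * d.+1 * j)%N.
  have := ltn_ceil n (ltn0Sn d); rewrite -/j; move: lej; rewrite /j0; nia.
have jn : (j * d.+1 <= n)%N by rewrite leq_trunc_div.
apply: (@lt_le_trans _ _ ((j%:R * u) ^+ d.+1)).
  apply: (@le_lt_trans _ _ ((2 * d.+1 * j)%:R ^+ d)).
    by rewrite lerXn2r ?nnegrE ?ler0n // ler_nat.
  rewrite natrM !exprMn [j%:R ^+ d.+1]exprSr -mulrA mulrC ltr_pM2l; last first.
    by rewrite exprn_gt0 // (le_lt_trans c0 cj).
  by rewrite -ltr_pdivrMr ?exprn_gt0.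
apply: (@le_trans _ _ (y ^+ (j * d.+1))); last by rewrite ler_eXn2l.
have y0 : 0 <= y by lra.
have ju0 : 0 <= j%:R * u by rewrite mulr_ge0 // ltW.
rewrite exprM lerXn2r ?nnegrE ?exprn_ge0 //.
have yu : y = 1 + u by rewrite /u; ring.
by rewrite yu (le_trans _ (@Bernoulli_le _ u j _)); lra.
Qed.

Lemma sumr_le_mean (R : realFieldType) (I : finType) (B : {set I}) (f : I -> R) (c : R) :
  (0 < #|B|)%N -> \sum_(i in B) f i <= c * #|B|%:R -> exists2 i, i \in B & f i <= c.
Proof.
move=> B0 le; have [/existsP [i /andP [iB fi]]|] := boolP [exists i in B, f i <= c].
  by exists i.
rewrite negb_exists => /forallP h.
have lt i : i \in B -> c < f i by move=> iB; have := h i; rewrite iB ltNge.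
have /card_gt0P [i0 i0B] := B0.
suff : c * #|B|%:R < \sum_(i in B) f i by rewrite ltNge le.
rewrite mulr_natr -sumr_const; apply: ltr_sum => //.
by apply/hasP; exists i0; rewrite ?mem_index_enum.
Qed.

Section Traces.
Variables (R : realType) (eps : R) (T : finType) (E : rel T).
Implicit Types (X A S : {set T}).

(* The sets {a | t(a, B) = 1} for eps-good B. *)
Definition traces : {set {set T}} :=
  [set S : {set T} | [exists B : {set T},
     [forall a, all_but_few eps B (fun b => E a b == (a \in S))]]].

Lemma tracesP S :
  reflect (exists B, forall a, truth_value eps E a B (a \in S)) (S \in traces).
Proof.
rewrite inE; apply: (iffP existsP) => -[B h]; exists B; first exact/forallP.
by apply/forallP.
Qed.

Lemma partial_tree_traces h X : (0 < #|T|)%N -> 0 <= eps <= 1 ->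
  partial_tree id traces h X ->
  exists X', [/\ X' \subset X, (1 - eps) ^+ h * #|X|%:R <= #|X'|%:R
               & partial_tree (nbhd E) [set: T] h X'].
Proof.
move=> /card_gt0P [x0 _] /andP [e0 e1]; elim: h X => [|h IH] X /=.
  by exists X; rewrite mul1r.
case=> S [/tracesP [B tB] t1 t2].
have B0 : (0 < #|B|)%N.
  rewrite lt0n; apply/eqP=> B0; have := tB x0.
  by rewrite /truth_value /all_but_few B0 mulr0 ltNge ler0n.
pose bad b := [set a in X | E a b != (a \in S)].
(* Double counting: each leaf disagrees with fewer than [eps * #|B|] members of [B], so an average
   [b] disagrees with at most [eps * #|X|] leaves. *)
have [b bB leb] : exists2 b, b \in B & #|bad b|%:R <= eps * #|X|%:R.
  apply: sumr_le_mean => //.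
  have -> : \sum_(b in B) #|bad b|%:R =
      \sum_(a in X) #|[set b in B | E a b != (a \in S)]|%:R :> R.
    rewrite -!natr_sum; congr (_%:R).
    transitivity (\sum_(b in B) \sum_(a in X | E a b != (a \in S)) 1)%N.
      by apply: eq_bigr => b _; rewrite sum1dep_card.
    rewrite (exchange_big_dep (mem X)) /=; last by move=> ? ? _ /andP [].
    apply: eq_bigr => a aX; rewrite sum1dep_card; apply: eq_card => b.
    by rewrite !inE aX.
  rewrite -mulrA mulrCA [#|X|%:R * _]mulr_natl -sumr_const.
  by apply: ler_sum => a _; apply: ltW; apply: tB.
pose X1 := X :\: bad b.
have agree a : a \in X1 -> (a \in nbhd E b) = (a \in S).
  by rewrite !inE; case: (a \in X); rewrite /= ?andbF // andbT negbK => /eqP.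
have sX1 : X1 \subset X by apply: subsetDl.
have cX1 : (1 - eps) * #|X|%:R <= #|X1|%:R.
  have := cardsID (bad b) X; rewrite (setIidPr _); last first.
    by apply/subsetP=> a; rewrite inE => /andP [].
  by move/(congr1 (fun n => n%:R : R)); rewrite natrD -/X1; lra.
have [Y1 [s1 c1 u1]] := IH _ (partial_tree_sub (setSI S sX1) t1).
have [Y2 [s2 c2 u2]] := IH _ (partial_tree_sub (setSD S sX1) t2).
have sN1 : Y1 \subset nbhd E b.
  by apply/subsetP=> a /(subsetP s1) /setIP [aX aS]; rewrite agree.
have sN2 : Y2 \subset ~: nbhd E b.
  by apply/subsetP=> a /(subsetP s2) /setDP [aX aS]; rewrite inE agree.
exists (Y1 :|: Y2); split.
- rewrite subUset (subset_trans s1) ?(subset_trans s2) //.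
    by rewrite (subset_trans (subsetDl _ _)).
  by rewrite (subset_trans (subsetIl _ _)).
- rewrite -(cardsID (nbhd E b) (Y1 :|: Y2)); case: (setU_split sN1 sN2) => -> ->.
  rewrite natrD exprSr -mulrA.
  have q0 : 0 <= (1 - eps) ^+ h by rewrite exprn_ge0 //; lra.
  apply: le_trans (ler_wpM2l q0 cX1) _.
  have := cardsID S X1; move/(congr1 (fun n => n%:R : R)); rewrite natrD => <-.
  by rewrite mulrDr; apply: lerD.
- exact: (partial_treeU (in_setT b) sN1 sN2 u1 u2).
Qed.

Lemma stable_no_trace_tree k h X :
  symmetric E -> irreflexive E -> edge_stable k E -> 0 <= eps <= 1 ->
  (\sum_(i < 3 * 2 ^ k - 3) 'C(h, i))%:R < (2 * (1 - eps)) ^+ h ->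
  ~ full_tree id traces h X.
Proof.
move=> symE irrE st eps01 big t.
have T0 : (0 < #|T|)%N.
  have /set0Pn [x _] := full_tree_neq0 t; apply/card_gt0P; by exists x.
have [X1 [_ c1 p1]] := full_tree_leaves t.
have [X2 [_ c2 p2]] := partial_tree_traces T0 eps01 p1.
apply: (stable_no_full_tree symE irrE st (full_tree_of_partial p2 _)).
rewrite -(ltr_nat R) (lt_le_trans big) //; apply: le_trans c2.
by rewrite c1 exprMn natrX mulrC.
Qed.

(** * Sets that no good set splits *)

(** Excellence with two separate proportions: the traces still come from [eps]-good sets, while the
    parts they cut off are measured by [zeta]. *)
Definition unsplit (zeta : R) A :=
  forall S, S \in traces ->
    #|A :&: S|%:R < zeta * #|A|%:R \/ #|A :\: S|%:R < zeta * #|A|%:R.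

Lemma excellent_of_unsplit A : unsplit eps A -> excellent eps E A.
Proof.
move=> bA B _ t tB; have /bA : [set a | t a] \in traces.
  by apply/tracesP; exists B => a; rewrite inE; apply: tB.
have -> : [set a in A | t a == true] = A :&: [set a | t a].
  by apply/setP=> a; rewrite !inE eqb_id.
by have -> : [set a in A | t a == false] = A :\: [set a | t a]
  by apply/setP=> a; rewrite !inE eqbF_neg andbC.
Qed.

(** As long as some trace splits the set, recurse into both parts, each of proportion at least
    [zeta]. Either some branch stops within [h] splits, or all of them together form the tree. *)
Lemma exists_unsplit (zeta : R) h A : 0 < zeta <= 1 -> A != set0 ->
  full_tree id traces h.+1 A \/
  exists A', [/\ A' \subset A, unsplit zeta A' & zeta ^+ h * #|A|%:R <= #|A'|%:R].
Proof.
move=> /andP [z0 z1]; elim: h A => [|h IH] A A0.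
all: have [/forallP /= bA|] := boolP [forall S : {set T}, (S \in traces) ==>
     (#|A :&: S|%:R < zeta * #|A|%:R) || (#|A :\: S|%:R < zeta * #|A|%:R)].
1,3: right; exists A; split=> //;
  [by move=> S ST; apply/orP; apply: (implyP (bA S))
  | by rewrite ler_piMl // exprn_ile1 // ltW].
all: rewrite negb_forall => /existsP [S]; rewrite negb_imply negb_or -!leNgt.
all: move=> /and3P [ST le1 le2].
all: have zA : 0 < zeta * #|A|%:R by rewrite mulr_gt0 // ltr0n card_gt0.
all: have n1 : A :&: S != set0 by rewrite -card_gt0 -(ltr_nat R) (lt_le_trans zA).
all: have n2 : A :\: S != set0 by rewrite -card_gt0 -(ltr_nat R) (lt_le_trans zA).
  by left; exists S.
have zh : 0 <= zeta ^+ h by rewrite exprn_ge0 // ltW.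
case: (IH _ n1) => [t1|[A' [sA bA cA]]]; last first.
  right; exists A'; split=> //; first by rewrite (subset_trans sA) ?subsetIl.
  by apply: le_trans cA; rewrite exprSr -mulrA ler_wpM2l.
case: (IH _ n2) => [t2|[A' [sA bA cA]]]; last first.
  right; exists A'; split=> //; first by rewrite (subset_trans sA) ?subsetDl.
  by apply: le_trans cA; rewrite exprSr -mulrA ler_wpM2l.
by left; exists S.
Qed.

End Traces.

(* Derandomised choice of a random m-subset: adding one element at a time keeps
   the exponential moment sum below its mean. *)
Lemma exists_subset_moment (R : realFieldType) (T I : finType) (G : {set I})
    (M : I -> {set T}) (A : {set T}) (rho : R) m :
  0 <= rho -> (m <= #|A|)%N ->
  (forall i, i \in G -> #|A :&: M i|%:R <= rho * (#|A| - m)%:R) ->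
  exists W : {set T}, [/\ W \subset A, #|W| = m &
    \sum_(i in G) 2 ^+ #|W :&: M i| <= #|G|%:R * (1 + rho) ^+ m].
Proof.
move=> r0; elim: m => [|m IH] lem hM.
  exists set0; rewrite sub0set cards0; split=> //.
  rewrite mulr1 -sumr_const; apply: ler_sum => i _; by rewrite set0I cards0.
have [|W [sW cW bW]] := IH (ltnW lem).
  move=> i iG; apply: le_trans (hM i iG) _; rewrite ler_wpM2l // ler_nat; lia.
have cD : #|A :\: W| = (#|A| - m)%N by rewrite cardsD (setIidPr sW) cW.
have [||x] := @sumr_le_mean R _ (A :\: W)
   (fun x => \sum_(i in G) 2 ^+ #|(x |: W) :&: M i|) (#|G|%:R * (1 + rho) ^+ m.+1).
- by rewrite cD subn_gt0.
- rewrite exchange_big /=.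
  (* Adding [x] doubles the [i]-th term exactly when [x] is in [M i]; averaged over [x] the factor
     is at most [1 + rho]. *)
  have step i : i \in G -> \sum_(x in A :\: W) 2 ^+ #|(x |: W) :&: M i| <=
      2 ^+ #|W :&: M i| * ((1 + rho) * #|A :\: W|%:R) :> R.
    move=> iG.
    have -> : \sum_(x in A :\: W) 2 ^+ #|(x |: W) :&: M i| =
       \sum_(x in A :\: W) 2 ^+ #|W :&: M i| * (1 + (x \in M i)%:R) :> R.
      apply: eq_bigr => x /setDP [xA xW]; have [xM|xM] := boolP (x \in M i).
        rewrite setIUl (setIidPl _) ?sub1set // cardsU1 inE (negbTE xW) /=.
        by rewrite exprSr.
      rewrite setIUl (_ : [set x] :&: M i = set0) ?set0U ?addr0 ?mulr1 //.
      by apply/eqP; rewrite setI_eq0 disjoints1.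
    rewrite -mulr_sumr ler_wpM2l ?exprn_ge0 ?ler0n //.
    rewrite big_split /= sumr_const mulrDl mul1r lerD //.
    rewrite -natr_sum -big_mkcondr /= sum1_card.
    apply: le_trans (le_trans (hM i iG) _); last first.
      by rewrite ler_wpM2l // ler_nat cD; lia.
    rewrite ler_nat; apply: subset_leq_card; apply/subsetP=> y.
    by rewrite unfold_in => /andP [/setDP [yA _] yM]; rewrite inE yA.
  apply: (@le_trans _ _
    (\sum_(i in G) 2 ^+ #|W :&: M i| * ((1 + rho) * #|A :\: W|%:R))).
    exact: ler_sum.
  by rewrite -mulr_suml exprSr !mulrA !ler_wpM2r // addr_ge0.
move=> xD lex; exists (x |: W); split=> //.
  by rewrite subUset sub1set sW andbT; case/setDP: xD.
by rewrite cardsU1; case/setDP: xD => _ ->; rewrite cW.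
Qed.

(** * Equitable partitions *)

Lemma exists_unsplit_subset (R : realType) (eps zeta : R) (T : finType) (E : rel T)
    (A : {set T}) m :
  0 < zeta <= 1 / 128 -> (0 < m <= #|A|)%N ->
  #|traces eps E|%:R < (1 + 2 * zeta) ^+ m ->
  unsplit eps E zeta A ->
  exists W : {set T}, [/\ W \subset A, #|W| = m & unsplit eps E (32 * zeta) W].
Proof.
move=> /andP [z0 z1] /andP [m0 mA] few bA.
have m0R : 0 < m%:R :> R by rewrite ltr0n.
have zm : 0 < zeta * m%:R by rewrite mulr_gt0.
(* [M S] is the side of [S] that is rare in [A]; it suffices that it stays rare in [W]. *)
pose M (S : {set T}) := if #|A :&: S|%:R < zeta * #|A|%:R then S else ~: S.
have hM S : S \in traces eps E -> #|A :&: M S|%:R < zeta * #|A|%:R.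
  rewrite /M => /bA; case: ifP => // _ [] //; by rewrite setDE.
have balW (W : {set T}) : #|W| = m ->
    (forall S, S \in traces eps E -> #|W :&: M S|%:R < 32 * zeta * m%:R) ->
    unsplit eps E (32 * zeta) W.
  move=> cW h S /h; rewrite cW /M; case: ifP => _ lt; [by left | right].
  by rewrite setDE.
(* If [m] is at least half of [#|A|], any subset will do, the proportion at most doubling. Otherwise
   [rho = 2 * zeta] is admissible in the moment bound. *)
have [le2|lt2] := leqP #|A| (2 * m).
  have [W sW cW] := exists_subset_card mA; exists W; split=> //.
  apply: balW => // S ST.
  have le1 : #|W :&: M S|%:R <= #|A :&: M S|%:R :> R.
    by rewrite ler_nat subset_leq_card // setSI.
  have le3 : zeta * #|A|%:R <= zeta * (2 * m%:R).
    by rewrite ler_wpM2l ?(ltW z0) // -natrM ler_nat.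
  by have := hM S ST; nra.
have [|//|S ST|W [sW cW bW]] :=
    @exists_subset_moment R T _ (traces eps E) M A (2 * zeta) m.
- by lra.
- apply: ltW; apply: (lt_le_trans (hM S ST)); rewrite -mulrA mulrCA.
  rewrite ler_wpM2l ?(ltW z0) // -natrM ler_nat; lia.
exists W; split=> //; apply: balW => // S ST; rewrite ltNge; apply/negP=> big.
set c := #|W :&: M S| in big.
(* This [q] is small enough for the [q]-th power of [1 + 2 * zeta] to be at most 2, and large enough
   for [32 * zeta * m <= c] to give [2 * m <= q * c]. The single term of [S] would then exceed the
   bound on the whole moment. *)
pose q := Num.truncn (1 / (4 * zeta)).
have v0 : 0 < 1 / (4 * zeta) by rewrite divr_gt0 //; lra.
have /andP [leq ltq] : q%:R <= 1 / (4 * zeta) < q.+1%:R.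
  by rewrite truncn_le ?truncnS_gt // ltW.
have z4 : 0 < 4 * zeta by lra.
rewrite ler_pdivlMr // in leq; rewrite ltr_pdivrMr // -natr1 in ltq.
have q8 : 1 <= 8 * zeta * q%:R by nra.
have q2 : (1 + 2 * zeta) ^+ q <= 2.
  have h1 : 1 / 2 <= (1 - 2 * zeta) ^+ q.
    by apply: le_trans (Bernoulli_le _ _); nra.
  have h2 : (1 + 2 * zeta) ^+ q * (1 - 2 * zeta) ^+ q <= 1.
    by rewrite -exprMn exprn_ile1 //; nra.
  have h3 : 0 <= (1 + 2 * zeta) ^+ q by rewrite exprn_ge0 //; lra.
  by nra.
have le2c : (2 * m <= q * c)%N.
  rewrite -(ler_nat R) !natrM.
  have : 8 * zeta * q%:R * (4 * m%:R) <= q%:R * c%:R.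
    by rewrite -!mulrA mulrCA mulrA [X in X <= _](_ : _ = q%:R * (32 * zeta * m%:R));
      [rewrite ler_wpM2l | ring].
  by have : 1 * (4 * m%:R) <= 8 * zeta * q%:R * (4 * m%:R);
    [rewrite ler_wpM2r // mulr_ge0 | nra].
have y1 : 1 <= 1 + 2 * zeta by lra.
have up : 2 ^+ c <= #|traces eps E|%:R * (1 + 2 * zeta) ^+ m.
  apply: le_trans bW; rewrite (bigD1 S) //= lerDl; apply: sumr_ge0 => i _.
  by rewrite exprn_ge0.
have low : (1 + 2 * zeta) ^+ (2 * m) <= 2 ^+ c.
  apply: (@le_trans _ _ ((1 + 2 * zeta) ^+ (q * c))); first by rewrite ler_weXn2l.
  by rewrite exprM lerXn2r ?nnegrE // exprn_ge0 //; lra.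
have := le_trans low up; rewrite mul2n -addnn exprD leNgt ltr_pM2r ?few //.
by rewrite exprn_gt0 //; lra.
Qed.

Lemma greedy_packing (T : finType) (P : {set T} -> Prop) (m r : nat) :
  (0 < m)%N ->
  (forall X : {set T}, (r <= #|X|)%N ->
     exists W : {set T}, [/\ W \subset X, #|W| = m & P W]) ->
  forall X : {set T}, exists Q : {set {set T}},
    [/\ trivIset Q, forall W, W \in Q -> #|W| = m /\ P W, cover Q \subset X
      & (#|X :\: cover Q| < r)%N].
Proof.
move=> m0 hP X; have [n] := ubnP #|X|; elim: n X => // n IH X; rewrite ltnS => leX.
have [ltr|/hP [W [sW cW PW]]] := ltnP #|X| r.
  exists set0; rewrite /cover big_set0 setD0 sub0set; split=> //.
    by apply/trivIsetP=> A B; rewrite inE.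
  by move=> W; rewrite inE.
have [|Q [tQ hQ sQ cQ]] := IH (X :\: W).
  by rewrite cardsD (setIidPr sW) cW; have := subset_leq_card sW; rewrite cW; lia.
have dis : [disjoint W & cover Q].
  rewrite disjoint_sym disjoints_subset (subset_trans sQ) // setDE; exact: subsetIr.
have W0 : W != set0 by rewrite -card_gt0 cW.
have WQ : W \notin Q.
  apply/negP=> WQ; case/set0Pn: W0 => x xW.
  have /negP := negbT (disjointFr dis xW); apply.
  by apply/bigcupP; exists W.
have cov : cover (W |: Q) = W :|: cover Q by rewrite /cover big_setU1.
exists (W |: Q); rewrite cov; split.
- apply/trivIsetP=> A B; rewrite !inE => /predU1P [->|AQ] /predU1P [->|BQ].
  + by rewrite eqxx.
  + by move=> _; apply: disjointWr dis; apply: bigcup_sup BQ.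
  + by move=> _; rewrite disjoint_sym; apply: disjointWr dis; apply: bigcup_sup AQ.
  + exact: (trivIsetP tQ).
- by move=> A; rewrite !inE => /predU1P [->|/hQ].
- by rewrite subUset sW (subset_trans sQ) // subsetDl.
- by rewrite -setDDl.
Qed.

(** Elements are labelled one at a time, each by a label least used so far. *)
Lemma equitable_labelling (T I : finType) (Q : {set I}) (i0 : I) (D : {set T}) :
  i0 \in Q -> exists2 f : T -> I, (forall x, f x \in Q) &
    forall i j, i \in Q -> j \in Q ->
      (#|[set x in D | f x == i]| <= #|[set x in D | f x == j]| + 1)%N.
Proof.
move=> i0Q; have [n] := ubnP #|D|; elim: n D => // n IH D; rewrite ltnS => leD.
have [->|/set0Pn [x xD]] := eqVneq D set0.
  exists (fun=> i0) => // i j _ _.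
  by rewrite (_ : [set _ in _ | _] = set0) ?cards0 //; apply/setP=> x; rewrite !inE.
have [|f fQ hf] := IH (D :\ x); first by move: leD; rewrite (cardsD1 x D) xD.
pose c i := #|[set y in D :\ x | f y == i]|.
have [i1 i1Q min1] : exists2 i1, i1 \in Q & forall j, j \in Q -> (c i1 <= c j)%N.
  by case: (arg_minnP c i0Q) => i1 i1Q h; exists i1.
pose g y := if y == x then i1 else f y.
have cg i : #|[set y in D | g y == i]| = ((i1 == i) + c i)%N.
  rewrite (cardsD1 x) !inE xD /g eqxx /=; congr (_ + _)%N; apply: eq_card => y.
  by rewrite !inE; case: (y == x) => //=; rewrite andbT.
exists g => [y|i j iQ jQ]; first by rewrite /g; case: ifP.
rewrite !cg; have := hf i j iQ jQ; rewrite -/(c i) -/(c j).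
have := min1 j jQ; case: eqP => [<-|_] /=; lia.
Qed.

(** The last bound says, without division, that a block outgrows its [W] by at most the average
    share of the leftover plus one. *)
Lemma equitable_extension (T : finType) (Q : {set {set T}}) m :
  (0 < m)%N -> trivIset Q -> Q != set0 -> (forall W, W \in Q -> #|W| = m) ->
  exists P : {set {set T}},
    [/\ partition P [set: T], (#|P| <= #|Q|)%N,
        forall A B, A \in P -> B \in P -> (#|A| <= #|B| + 1)%N &
        forall A, A \in P -> exists W, [/\ W \in Q, W \subset A &
          (#|Q| * (#|A| - m) <= #|~: cover Q| + #|Q|)%N]].
Proof.
move=> m0 tQ /set0Pn [W0 W0Q] cQ.
have [f fQ hf] := equitable_labelling (~: cover Q) W0Q.
pose g x := if x \in cover Q then pblock Q x else f x.
have gQ x : g x \in Q by rewrite /g; case: ifP => // /pblock_mem.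
pose blk W := [set y | g y == W].
pose c W := #|[set x in ~: cover Q | f x == W]|.
have blkE W : W \in Q -> blk W = W :|: [set x in ~: cover Q | f x == W].
  move=> WQ; apply/setP=> y; rewrite !inE /g.
  have [yC|yC] := boolP (y \in cover Q); rewrite /= ?orbF.
    apply/eqP/idP=> [<-|yW]; first by rewrite mem_pblock.
    exact: def_pblock.
  suff /negbTE -> : y \notin W by [].
  by apply: contra yC => yW; apply/bigcupP; exists W.
have cblk W : W \in Q -> #|blk W| = (m + c W)%N.
  move=> WQ; rewrite blkE // cardsU cQ // disjoint_setI0 ?cards0 ?subn0 //.
  rewrite disjoints_subset; apply/subsetP=> y yW; rewrite !inE negb_and negbK.
  by apply/orP; left; apply/bigcupP; exists W.
have inP A : A \in preim_partition g [set: T] -> exists2 W, W \in Q & A = blk W.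
  case/imsetP=> x _ ->; exists (g x) => //; apply/setP=> y.
  by rewrite !inE eq_sym.
have sumc : (\sum_(W in Q) c W)%N = #|~: cover Q|.
  rewrite -sum1_card (partition_big f (mem Q)) //=.
  by apply: eq_bigr => W _; rewrite sum1dep_card.
exists (preim_partition g [set: T]); split.
- exact: preim_partitionP.
- apply: leq_trans (leq_imset_card blk Q); apply: subset_leq_card.
  by apply/subsetP=> A /inP [W WQ ->]; apply: imset_f.
- move=> A B /inP [W WQ ->] /inP [W' WQ' ->].
  by rewrite !cblk // -addnA leq_add2l hf.
- move=> A /inP [W WQ ->]; exists W; split=> //; first by rewrite blkE // subsetUl.
  rewrite cblk // addKn -sumc -[X in (_ <= _ + X)%N]sum1_card -big_split /=.
  rewrite -sum_nat_const; apply: leq_sum => W' WQ'; exact: hf.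
Qed.

(** Singletons are good, with adjacency as truth value, so excellence of [B] makes [B] good;
    excellence of [A] is then applied to [B]. *)
Lemma uniform_of_excellent (R : realType) (eps : R) (T : finType) (E : rel T)
    (A B : {set T}) :
  symmetric E -> 0 < eps -> excellent eps E A -> excellent eps E B ->
  uniform eps E A B.
Proof.
move=> symE e0 xA xB.
have gB : good eps E B.
  move=> b; have gb : good eps E [set b].
    move=> x; rewrite !cards1 mulr1; have [Exb|Exb] := boolP (E x b).
      right; rewrite (_ : [set _ in _ | _] = set0) ?cards0 //.
      by apply/setP=> y; rewrite !inE; case: eqP => // ->; rewrite Exb.
    left; rewrite (_ : [set _ in _ | _] = set0) ?cards0 //.
    by apply/setP=> y; rewrite !inE; case: eqP => // ->; rewrite (negbTE Exb).
  have tb a : truth_value eps E a [set b] (E a b).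
    rewrite /truth_value /all_but_few cards1 mulr1.
    rewrite (_ : [set _ in _ | _] = set0) ?cards0 //.
    by apply/setP=> y; rewrite !inE; case: eqP => // ->; rewrite eqxx.
  have := xB _ gb _ tb.
  have -> : [set a in B | E a b == true] = [set a in B | E b a].
    by apply/setP=> a; rewrite !inE eqb_id symE.
  by have -> : [set a in B | E a b == false] = [set a in B | ~~ E b a];
    first by apply/setP=> a; rewrite !inE eqbF_neg symE.
pose t a := all_but_few eps B (fun b => E a b == true).
have tB a : truth_value eps E a B (t a).
  rewrite /truth_value; case ta : (t a) => //; move: ta; rewrite /t /all_but_few.
  have e v : [set b in B | ~~ (E a b == v)] = [set b in B | E a b == ~~ v].
    by apply/setP=> b; rewrite !inE; case: (E a b); case: v.
  rewrite !e /= => na; case: (gB a).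
    by congr (_ < _); congr (_%:R); apply: eq_card => b; rewrite !inE eqb_id.
  suff -> : [set b in B | ~~ E a b] = [set b in B | E a b == false] by rewrite na.
  by apply/setP=> b; rewrite !inE eqbF_neg.
case: (xA B gB t tB) => lt; [exists false | exists true];
  apply: le_lt_trans lt; rewrite ler_nat; apply: subset_leq_card;
  apply/subsetP=> a; rewrite !inE => /andP [-> /=];
  have := tB a; rewrite /truth_value; case: (t a) => // h; by rewrite h.
Qed.

Lemma stable_partition (R : realType) (eps : R) (k h : nat) :
  0 < eps < 1 / 2 ->
  (\sum_(i < 3 * 2 ^ k - 3) 'C(h.+1, i))%:R < (2 * (1 - eps)) ^+ h.+1 ->
  exists n0 : nat, forall (T : finType) (E : rel T),
    symmetric E -> irreflexive E -> edge_stable k E -> (n0 <= #|T|)%N ->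
    exists P : {set {set T}},
      [/\ partition P [set: T], #|P|%:R <= 2 * (64 / eps) ^+ h.+1,
          forall A B, A \in P -> B \in P -> (#|A| <= #|B| + 1)%N &
          forall A, A \in P -> excellent eps E A].
Proof.
move=> /andP [e0 e2] big.
(* The pieces will be [32 * z]-unsplit, and the vertices spread over them later add at most
   [3 * z * m] to a minority, which stays within [64 * z = eps]. *)
pose z := eps / 64; have z0 : 0 < z by rewrite /z; lra.
have z1 : z <= 1 / 128 by rewrite /z; lra.
have zE : 64 * z = eps by rewrite /z; field.
pose s := z ^+ h.+1; have s0 : 0 < s by rewrite exprn_gt0.
pose w := (Num.truncn (2 / s)).+1.
have ws : 2 < w%:R * s by rewrite -ltr_pdivrMr // truncnS_gt.
have y1 : 1 < 1 + 2 * z by lra.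
(* The factor [w], for which [n <= w * m], turns growth in [n] into growth in [m]: a [w]-th root
   will bound the number of traces by a power with exponent [m]. *)
have [n1 hn1] := exp_gt_poly (2 ^ h.+1 * w) y1.
(* This makes [z * m >= 1], which absorbs the extra vertex of an uneven distribution. *)
pose n2 := (Num.truncn (2 / (z * s))).+1.
exists (maxn n1 n2) => T E symE irrE st; rewrite geq_max => /andP [le1 le2].
set n := #|T| in le1 le2.
have zs0 : 0 < z * s by rewrite mulr_gt0.
have nzs : 2 < n%:R * (z * s).
  rewrite -ltr_pdivrMr //; apply: lt_le_trans (truncnS_gt _) _.
  by rewrite ler_nat.
have n0R : 0 <= n%:R :> R by [].
have sn : 2 < z * (s * n%:R) by nra.
pose m := Num.truncn (s * n%:R).
have sn0 : 0 <= s * n%:R by rewrite mulr_ge0 // ltW.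
have mle : m%:R <= s * n%:R by rewrite truncn_le.
have mgt : s * n%:R < m%:R + 1 by rewrite natr1 truncnS_gt.
have zm1 : 1 <= z * m%:R by nra.
have m1 : 1 <= m%:R :> R by nra.
have m0 : (0 < m)%N by rewrite -(ltr_nat R); lra.
have nwm : (n <= w * m)%N.
  have sw : s * n%:R <= s * (w%:R * m%:R) by nra.
  by rewrite -(ler_nat R) natrM; rewrite ler_pM2l in sw.
have T0 : (0 < n)%N by rewrite -(ltr_nat R); nra.
have noT X : ~ full_tree id (traces eps E) h.+1 X.
  by apply: stable_no_trace_tree symE irrE st _ big; lra.
have few : #|traces eps E|%:R < (1 + 2 * z) ^+ m.
  have cF : #|traces eps E|%:R <= n.+1%:R ^+ (2 ^ h.+1) :> R.
    by rewrite -natrX ler_nat; apply: card_family_le.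
  apply: le_lt_trans cF _.
  have wn0 : (0 < w)%N by [].
  rewrite -(@ltr_pXn2r _ w) ?nnegrE ?exprn_ge0 //; [|lra].
  rewrite -!exprM; apply: lt_le_trans (hn1 n le1) _.
  by rewrite ler_weXn2l ?(ltW y1) // mulnC.
(* From [r] vertices on, the unsplit subset has at least [m] elements; as [m <= s * n], fewer than
   [r] left over means at most [z * n]. *)
pose r := (Num.truncn (m%:R / z ^+ h)).+1.
have zh0 : 0 < z ^+ h by rewrite exprn_gt0.
have [|Q [tQ hQ _ cQ]] := @greedy_packing T (unsplit eps E (32 * z)) m r m0 _ [set: T].
  move=> X rX; have mX : m%:R < z ^+ h * #|X|%:R.
    rewrite mulrC -ltr_pdivrMr //; apply: lt_le_trans (truncnS_gt _) _.
    by rewrite ler_nat.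
  have X0 : X != set0 by rewrite -card_gt0 (leq_trans _ rX).
  have [|/noT //|[A [sA bA cA]]] := @exists_unsplit R eps T E z h X _ X0.
    by rewrite z0; lra.
  have mA : (m <= #|A|)%N by rewrite -(ler_nat R); lra.
  have [||W [sW cW bW]] := @exists_unsplit_subset R eps z T E A m _ _ few bA.
  - by rewrite z0.
  - by rewrite m0.
  by exists W; split=> //; apply: subset_trans sA.
rewrite setTD in cQ.
have rem : #|~: cover Q|%:R <= z * n%:R.
  apply: (@le_trans _ _ (m%:R / z ^+ h)).
    apply: (@le_trans _ _ (Num.truncn (m%:R / z ^+ h))%:R).
      by rewrite ler_nat -ltnS.
    by rewrite truncn_le // divr_ge0 // ltW.
  by rewrite ler_pdivrMr // mulrAC -exprS.
have cardQ : #|cover Q| = (#|Q| * m)%N.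
  rewrite -(eqP tQ) -sum_nat_const; apply: eq_bigr => W /hQ [] //.
have nE : n%:R = #|Q|%:R * m%:R + #|~: cover Q|%:R :> R.
  by rewrite -natrM -natrD -cardQ cardsC.
have Q0 : Q != set0.
  apply/eqP=> Q0; move: nE rem; rewrite Q0 cards0 mul0r add0r => <-.
  have n1R : 1 <= n%:R :> R by rewrite ler1n.
  by nra.
have [P [pP cP eP hP]] := equitable_extension m0 tQ Q0 (fun W WQ => (hQ W WQ).1).
have q0 : 0 < #|Q|%:R :> R by rewrite ltr0n card_gt0.
exists P; split=> //.
  apply: (@le_trans _ _ #|Q|%:R); first by rewrite ler_nat.
  (* The disjoint pieces have size [m], at least half of [s * n], so there are at most [2 / s] of
     them. *)
  have -> : (64 / eps) ^+ h.+1 = s^-1 by rewrite /s /z -exprVn invf_div.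
  rewrite ler_pdivlMr //.
  have qm : #|Q|%:R * m%:R <= n%:R :> R by rewrite nE lerDl.
  have m2 : s * n%:R <= 2 * m%:R by lra.
  have nR : 0 < n%:R :> R by rewrite ltr0n.
  have : #|Q|%:R * (s * n%:R) <= 2 * n%:R by nra.
  by rewrite mulrA ler_pM2r.
move=> A /hP [W [/hQ [cW bW] sW leA]].
apply: excellent_of_unsplit.
pose c := (#|A| - m)%N.
have cA : #|A| = (m + c)%N by rewrite subnKC // -cW subset_leq_card.
have {leA} leA : #|Q|%:R * c%:R <= #|~: cover Q|%:R + #|Q|%:R :> R.
  by rewrite -natrM -natrD ler_nat.
have cz : c%:R <= 3 * (z * m%:R).
  have n2R : n%:R <= 2 * (#|Q|%:R * m%:R) :> R by nra.
  have le3 : z * n%:R <= z * (2 * (#|Q|%:R * m%:R)) by rewrite ler_wpM2l // ltW.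
  have le4 : #|Q|%:R * 1 <= #|Q|%:R * (z * m%:R) by rewrite ler_pM2l.
  by rewrite -(ler_pM2l q0); lra.
have minority (S : {set T}) : #|W :&: S|%:R < 32 * z * #|W|%:R ->
    #|A :&: S|%:R < eps * #|A|%:R.
  move=> lt; have : (#|A :&: S| <= #|W :&: S| + c)%N.
    rewrite -(cardsID W (A :&: S)); apply: leq_add.
      by apply: subset_leq_card; rewrite -setIA (setIC S) setIA setSI // subsetIr.
    have -> : c = #|A :\: W| by rewrite cardsD (setIidPr sW) cW.
    by apply: subset_leq_card; rewrite setSD // subsetIl.
  rewrite -(ler_nat R) natrD cA natrD cW in lt *.
  have c0 : 0 <= z * c%:R by rewrite mulr_ge0 // ltW.
  by nra.
move=> S /bW; rewrite !setDE => -[/minority|/minority]; by [left | right].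
Qed.

(** * Tree height and number of pieces *)

Lemma exists_tree_height (R : realType) (eps : R) (k : nat) :
  (1 <= k)%N -> 0 < eps < 1 / 2 ->
  exists h : nat,
    (\sum_(i < 3 * 2 ^ k - 3) 'C(h.+1, i))%:R < (2 * (1 - eps)) ^+ h.+1 /\
    (eps < 1 / 2 ^+ tree_bound k -> h.+1 = (3 * 2 ^ k - 3)%N).
Proof.
move=> k1 /andP [e0 e2]; set d := (3 * 2 ^ k - 3)%N.
pose K := (2 ^ k)%N; have K2 : (2 <= K)%N by rewrite (@leq_pexp2l 2 1 k).
(* For small [eps] height [d] suffices: the binomial sum is [2 ^ d - 1], and by Bernoulli the leaves
   lost number at most [d * 2 ^ d * eps < 1]. Otherwise a power of [2 * (1 - eps) > 1] eventually
   beats the polynomial. *)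
have [small|large] := ltP eps (1 / 2 ^+ tree_bound k).
  exists d.-1; have -> : d.-1.+1 = d by rewrite /d -/K; lia.
  split=> //.
  have sumd : (\sum_(i < d) 'C(d, i)).+1 = (2 ^ d)%N.
    rewrite -[2%N]/(1 + 1)%N expnDn big_ord_recr /= binn subnn !exp1n addn1.
    by congr _.+1; apply: eq_bigr => i _; rewrite !exp1n !muln1.
  have -> : (\sum_(i < d) 'C(d, i))%:R = 2 ^+ d - 1 :> R.
    by rewrite -natrX -sumd -natr1 addrK.
  have B : 1 - d%:R * eps <= (1 - eps) ^+ d.
    by have := @Bernoulli_le R (- eps) d; rewrite mulrN; apply; lra.
  have dK : (d * 2 ^ d <= 2 ^ tree_bound k)%N.
    have -> : tree_bound k = (K.+1 + d)%N.
      by rewrite /tree_bound expnD /d -/K; lia.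
    rewrite expnD leq_mul2r; apply/orP; right.
    have lt2 j : (j < 2 ^ j)%N by apply: ltn_expl.
    have : (2 * K <= 2 ^ K)%N.
      case: (K) K2 => [|j] // _; rewrite expnS leq_mul2l /=; exact: lt2.
    by rewrite expnS /d -/K; lia.
  have t0 : 0 < 2 ^+ tree_bound k :> R by rewrite exprn_gt0.
  have te : 2 ^+ tree_bound k * eps < 1 by rewrite mulrC -ltr_pdivlMr.
  have dR : d%:R * 2 ^+ d * eps <= 2 ^+ tree_bound k * eps.
    by rewrite ler_wpM2r ?(ltW e0) // -!natrX -natrM ler_nat.
  have d0 : 0 < 2 ^+ d :> R by rewrite exprn_gt0.
  by rewrite exprMn; nra.
have y1 : 1 < 2 * (1 - eps) by lra.
have [n0 hn0] := exp_gt_poly d y1.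
exists n0; split=> //.
apply: le_lt_trans (hn0 n0.+1 (leqnSn _)).
by rewrite -natrX ler_nat; apply: sum_bin_le.
Qed.

(** With [j = 2 ^ k - 1] the exponents are [3 * j] and [4 * j]. The spare [j] factors [8 / eps],
    each at least [8 ^ 3], absorb the factor 8 in [64 / eps = 8 * (8 / eps)]. *)
Lemma partition_count_bound (R : realType) (eps : R) (k : nat) :
  (1 <= k)%N -> 0 < eps -> eps < 1 / 2 ^+ tree_bound k ->
  2 * (64 / eps) ^+ (3 * 2 ^ k - 3) <= 4 * (8 / eps) ^+ (tree_bound k - 2).
Proof.
move=> k1 e0 small; pose K := (2 ^ k)%N.
have K2 : (2 <= K)%N by rewrite (@leq_pexp2l 2 1 k).
pose j := K.-1; have jE : K = j.+1 by rewrite prednK // ltnW.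
have -> : (3 * 2 ^ k - 3 = 3 * j)%N by rewrite -/K; lia.
have tE : (tree_bound k = 4 * j + 2)%N by rewrite /tree_bound expnD -/K; lia.
have -> : (tree_bound k - 2 = 3 * j + j)%N by lia.
have v0 : 0 < 8 / eps by rewrite divr_gt0.
have v9 : 8 ^+ 3 <= 8 / eps.
  rewrite ler_pdivlMr //; have t0 : 0 < 2 ^+ tree_bound k :> R by rewrite exprn_gt0.
  have te : eps * 2 ^+ tree_bound k < 1 by rewrite -ltr_pdivlMr.
  have : 2 ^+ 6 <= 2 ^+ tree_bound k :> R by rewrite ler_weXn2l ?ler1n // tE; lia.
  by nra.
have -> : 64 / eps = 8 * (8 / eps) by ring.
rewrite exprMn exprD [8 ^+ (3 * j)]exprM.
have vj : (8 ^+ 3) ^+ j <= (8 / eps) ^+ j by rewrite lerXn2r ?nnegrE ?exprn_ge0 // ltW.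
have w0 : 0 < (8 / eps) ^+ (3 * j) by rewrite exprn_gt0.
have u0 : 0 <= (8 / eps) ^+ j by rewrite exprn_ge0 // ltW.
by nra.
Qed.

(** A set and its complement cannot both have proportion at least [eps > 1 / 2]. *)
Lemma trivial_partition (R : realType) (eps : R) (T : finType) (E : rel T) :
  1 / 2 < eps -> (0 < #|T|)%N ->
  excellent eps E [set: T] /\ uniform eps E [set: T] [set: T].
Proof.
move=> e2 T0; have n0 : 0 < #|[set: T]|%:R :> R by rewrite ltr0n cardsT.
have half (p : pred T) : #|[set x in [set: T] | p x]|%:R < eps * #|[set: T]|%:R \/
    #|[set x in [set: T] | ~~ p x]|%:R < eps * #|[set: T]|%:R.
  have := cardsID [set x | p x] [set: T].
  rewrite (_ : _ :&: _ = [set x in [set: T] | p x]); last first.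
    by apply/setP=> x; rewrite !inE.
  rewrite (_ : _ :\: _ = [set x in [set: T] | ~~ p x]); last first.
    by apply/setP=> x; rewrite !inE andbT.
  move/(congr1 (fun n => n%:R : R)); rewrite natrD.
  set u := #|_|%:R; set v := #|_|%:R; set n := #|_|%:R in n0 * => uv.
  by have [|le] := ltP u (eps * n); [left | right; nra].
split.
  move=> B _ t _; case: (half t); [left|right]; first by under eq_finset do rewrite eqb_id.
  by under eq_finset do rewrite eqbF_neg.
pose p a := all_but_few eps [set: T] (fun b => E a b == true).
have np a : ~~ p a -> all_but_few eps [set: T] (fun b => E a b == false).
  rewrite /p /all_but_few; case: (half (fun b => E a b == false)) => // h /negP [].
  apply: le_lt_trans h; rewrite ler_nat; apply: subset_leq_card.
  by apply/subsetP=> b; rewrite !inE; case: (E a b).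
case: (half p) => h; [exists false | exists true => //].
apply: le_lt_trans h; rewrite ler_nat; apply: subset_leq_card.
by apply/subsetP=> a; rewrite !inE /= => na; apply: contraR na => /np.
Qed.

(* The single value eps = 1/2 is excluded because the claim is false there
   (already for k = 9): in the join of two perfect matchings on 2^j vertices
   each, no nonempty set of even size is 1/2-excellent, so an equitable partition
   into 1/2-excellent pieces can only consist of singletons. *)
Theorem theorem1p15 (R : realType) (k : nat) (eps : R) :
  (1 <= k)%N -> 0 < eps -> eps <> 1 / 2 ->
  exists N n0 : nat,
    (eps < 1 / 2 ^+ tree_bound k ->
       N%:R <= 4 * (8 / eps) ^+ (tree_bound k - 2)) /\
    forall (T : finType) (E : rel T),
      symmetric E -> irreflexive E -> edge_stable k E -> (n0 <= #|T|)%N ->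
      exists P : {set {set T}},
        [/\ partition P [set: T],
            (#|P| <= N)%N,
            forall A B, A \in P -> B \in P -> (#|A| <= #|B| + 1)%N,
            forall A, A \in P -> excellent eps E A &
            forall A B, A \in P -> B \in P -> uniform eps E A B].
Proof.
move=> k1 e0 /eqP ne; have [lt|gt|eq] := ltgtP eps (1 / 2); last first.
- by rewrite eq eqxx in ne.
(* Above one half a single piece works, and the bound on [N] is vacuous. *)
- exists 1, 1; split=> [small|T E _ _ _ T0].
    have : 1 / 2 ^+ tree_bound k <= 1 / 2 :> R.
      rewrite !div1r lef_pV2 ?posrE ?exprn_gt0 // -[leLHS]expr1 ler_weXn2l ?ler1n //.
      by rewrite /tree_bound expnD; have := expn_gt0 2 k; lia.
    lra.
  have [xT uT] := trivial_partition E gt T0.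
  exists [set [set: T]]; split; last 3 first.
  - by move=> A B /set1P -> /set1P ->; rewrite leq_addr.
  - by move=> A /set1P ->.
  - by move=> A B /set1P -> /set1P ->.
  - rewrite /partition /cover big_set1 eqxx inE eq_sym -card_gt0 cardsT T0 andbT /=.
    by apply/trivIsetP=> A B /set1P -> /set1P ->; rewrite eqxx.
  - by rewrite cards1.
have e02 : 0 < eps < 1 / 2 by rewrite e0.
have [h [big hE]] := exists_tree_height k1 e02.
have [n0 part] := stable_partition e02 big.
pose v := 2 * (64 / eps) ^+ h.+1.
have v0 : 0 <= v by rewrite mulr_ge0 // exprn_ge0 // divr_ge0 // ltW.
exists (Num.truncn v), n0; split=> [small|T E symE irrE st nT].
  apply: (@le_trans _ _ v); first by rewrite truncn_le.
  by rewrite /v hE // partition_count_bound.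
have [P [pP cP eP xP]] := part T E symE irrE st nT.
exists P; split=> //; first by rewrite truncn_ge_nat.
by move=> A B AP BP; apply: uniform_of_excellent => //; apply: xP.
Qed.
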